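(* Let $A$ be an $m\times n$ matrix over $GF(2)$ with columns labeled, in order, by $x_1,\dots,x_n$, and let $U=\{x_1,\dots,x_n\}$ be the set of column labels. Then the relation $R(A)$ is an equivalence relation on $U$.
   Context: $GF(2)$ is the two-element field. The null space is $\mathcal{N}_{GF(2)}(A)=\{\mathbf{x}\in GF(2)^n: A\mathbf{x}=\mathbf{0}\}$. The relation $R(A)=R_{GF(2)}(A)$ on $U$ is defined by: for all $x_i,x_j\in U$, $(x_i,x_j)\in R(A)$ iff $x_i=x_j$ or $\mathbf{e}_i+\mathbf{e}_j\in\mathcal{N}_{GF(2)}(A)$, where $\mathbf{e}_i\in GF(2)^n$ is the vector whose only nonzero coordinate is the $i$-th (equal to $1$). *)

(* Defs.v *)
From Stdlib Require Relation_Definitions.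
From mathcomp Require Import all_boot all_algebra.

Set Implicit Arguments.
Unset Strict Implicit.
Unset Printing Implicit Defensive.

Import GRing.Theory.
Local Open Scope ring_scope.

Definition null_space (m n : nat) (A : 'M['F_2]_(m, n)) : {set 'cV['F_2]_n} :=
  [set v | A *m v == 0].

Definition unit_vec (n : nat) (i : 'I_n) : 'cV['F_2]_n := delta_mx i 0.

(* [x i] is the label of column [i].  A pair of labels is related through column
   indices carrying them; for distinct labels these indices are unique, see
   [col_relE]. *)
Definition col_rel (m n : nat) (U : Type) (x : 'I_n -> U)
    (A : 'M['F_2]_(m, n)) : Relation_Definitions.relation U :=
  fun u v => exists i j : 'I_n, [/\ u = x i, v = x j
    & x i = x j \/ unit_vec i + unit_vec j \in null_space A].

Lemma col_relE (m n : nat) (U : Type) (x : 'I_n -> U)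
    (A : 'M['F_2]_(m, n)) (i j : 'I_n) :
  injective x ->
  col_rel x A (x i) (x j) <->
  (x i = x j \/ unit_vec i + unit_vec j \in null_space A).
Proof.
move=> injx; split; last by move=> h; exists i, j; split.
by case=> i' [j' [/injx -> /injx ->]].
Qed.

(* Main.v *)
(* In characteristic 2, e_i + e_j is in the null space iff A e_i = A e_j, so
   R(A) relates two labels iff their columns are equal. *)
Require Import Defs.
From Stdlib Require Relation_Definitions.
From mathcomp Require Import all_boot all_algebra.

Import GRing.Theory.
Local Open Scope ring_scope.

(** Over GF(2) signs vanish, so [A] kills e_i + e_j exactly when columns i and j agree
    ([unit_vecD_null_space]). Hence R(A) is equality pulled back along the map from labels to
    columns ([col_rel_eq_col]), and it inherits the three laws from equality. *)

Lemma F2_addmx_eq0 (m n : nat) (B C : 'M['F_2]_(m, n)) :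
  (B + C == 0) = (B == C).
Proof.
rewrite addr_eq0; congr (_ == _); apply/matrixP => i j.
by rewrite mxE oppr_pchar2 ?pchar_Fp.
Qed.

Lemma unit_vecD_null_space (m n : nat) (A : 'M['F_2]_(m, n)) (i j : 'I_n) :
  (unit_vec i + unit_vec j \in null_space A) = (col i A == col j A).
Proof. by rewrite inE mulmxDr F2_addmx_eq0 !colE. Qed.

Lemma col_rel_eq_col (m n : nat) (A : 'M['F_2]_(m, n))
    (U : Type) (x : 'I_n -> U) (i j : 'I_n) :
  injective x -> col_rel x A (x i) (x j) <-> col i A = col j A.
Proof.
move=> injx; apply: (iff_trans (col_relE A i j injx)).
rewrite unit_vecD_null_space; split; first by case=> [/injx ->|/eqP].
by move=> ->; right.
Qed.

Theorem proposition8 (m n : nat) (A : 'M['F_2]_(m, n))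
    (U : Type) (x : 'I_n -> U) (x_labels : bijective x) :
  Relation_Definitions.equivalence U (col_rel x A).
Proof.
have injx := bij_inj x_labels; case: x_labels => g _ gK.
(* Every label [u] is [x (g u)], so the criterion on indices extends to arbitrary labels. *)
have relE u v : col_rel x A u v <-> col (g u) A = col (g v) A.
  by rewrite -{1}(gK u) -{1}(gK v); apply: col_rel_eq_col.
split=> [u|u v w /relE uv /relE vw|u v /relE uv]; apply/relE => //.
by rewrite uv.
Qed.
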